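(* Let $G$ be a graph with maximum degree $\Delta(G)$ and minimum degree $\delta(G)$, and let $k$ be an integer with $k>\delta(G)$. Then $C_k(G)\le \Delta(G)-k+3$.
   Context: All graphs are finite, simple and undirected. For an integer $k\ge 1$, a set $S\subseteq V(G)$ is a $k$-dominating set of $G$ if every vertex of $V(G)\setminus S$ has at least $k$ neighbours in $S$. Two sets $U_1,U_2\subseteq V(G)$ form a $k$-coalition if neither $U_1$ nor $U_2$ is a $k$-dominating set of $G$, but $U_1\cup U_2$ is. A $k$-coalition partition of $G$ is a partition $\Theta$ of $V(G)$ into nonempty sets such that every set of $\Theta$ either is a $k$-dominating set of $G$ with exactly $k$ elements, or forms a $k$-coalition with some other set of $\Theta$. The $k$-coalition number $C_k(G)$ is the maximum number of sets in a $k$-coalition partition of $G$.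
   Formalization: The formal theorem also assumes k ≤ Δ(G)+1; without it the claim fails: for k ≥ Δ(G)+2 only V(G) is k-dominating, so any graph with at least two vertices has C_k(G) = 2 > Δ(G)−k+3 (e.g. two isolated vertices, k = 2). *)

(* Defs.v *)
(* MathComp.  A finite simple graph is a symmetric irreflexive relation on a
   finType of vertices. *)
From mathcomp Require Import all_boot all_order all_algebra.

Set Implicit Arguments.
Unset Strict Implicit.
Unset Printing Implicit Defensive.

Section KCoalition.

Variables (V : finType) (e : rel V).

Implicit Types (S U : {set V}) (P : {set {set V}}) (v : V) (k : nat).

Definition neighbours v : {set V} := [set w | e v w].

Definition degree v : nat := #|neighbours v|.

Definition max_degree : nat := \max_(v : V) degree v.

(* Degrees never exceed #|V|, so this default is inert as soon as V is
   nonempty. *)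
Definition min_degree : nat := \big[minn/#|V|]_(v : V) degree v.

Definition k_dominating k S : bool :=
  [forall v in ~: S, k <= #|neighbours v :&: S|].

Definition k_coalition k U1 U2 : bool :=
  [&& ~~ k_dominating k U1, ~~ k_dominating k U2 & k_dominating k (U1 :|: U2)].

Definition k_coalition_partition k P : bool :=
  partition P [set: V] &&
  [forall U in P,
     (k_dominating k U && (#|U| == k))
     || [exists U' in P, (U' != U) && k_coalition k U U']].

(* This maximum is 0 when there is no k-coalition partition (for instance one
   vertex and k = 2).  If V is nonempty and k exceeds the minimum degree, a
   partition does exist for #|V| >= 2 (split off a vertex of degree < k), as it
   does for #|V| = 1 and k = 1. *)
Definition k_coalition_number k : nat :=
  \max_(P : {set {set V}} | k_coalition_partition k P) #|P|.

End KCoalition.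

(* Main.v *)
Require Import Defs.
From mathcomp Require Import all_boot all_order all_algebra.
From mathcomp Require Import zify.
Import Order.TTheory GRing.Theory Num.Theory.
Local Open Scope ring_scope.

(* Every k-dominating set contains each vertex v of degree < k, so in a
   k-coalition partition with at least two sets, the set A containing v is not
   k-dominating and every other set forms a k-coalition with A.  Take u outside A
   with a < k neighbours in A.  Each of the m sets other than A and the one
   containing u has at least k - a neighbours of u, so
   Delta >= a + m(k - a) >= k + m - 1 as soon as m >= 1.  Partitions into at most
   two sets are covered by k <= Delta + 1. *)

Lemma exists_low_degree {V : finType} {e : rel V} {k : nat} :
  (min_degree e < k)%N -> V -> exists v, (degree e v < k)%N.
Proof.
have [|all_ge] := boolP [exists v, (degree e v < k)%N].
  by move=> /existsP[v ?] _ _; exists v.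
move=> lt_min v0; exfalso; move: lt_min; rewrite ltnNge => /negP; apply.
have deg_ge v : (k <= degree e v)%N.
  by rewrite leqNgt; apply: contra all_ge => ?; apply/existsP; exists v.
(* The default [#|V|] is also at least [k], since it bounds the degree of [v0]. *)
rewrite /min_degree; elim/big_ind: _ => [|x y lex ley|v _] //.
- exact: leq_trans (deg_ge v0) (max_card _).
- by rewrite leq_min lex.
Qed.

Lemma k_dominating_low_degree {V : finType} {e : rel V} {k : nat}
    {S : {set V}} {v : V} :
  (degree e v < k)%N -> k_dominating e k S -> v \in S.
Proof.
move=> lt_vk /forall_inP domS; apply: contraLR lt_vk => vNS.
rewrite -leqNgt (leq_trans (domS v _)) ?inE //.
by apply: subset_leq_card; apply: subsetIl.
Qed.

Lemma sum_card_setI_partition {T : finType} {P : {set {set T}}} (N : {set T}) :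
  partition P [set: T] -> (\sum_(B in P) #|N :&: B| = #|N|)%N.
Proof.
move=> partP; rewrite -sum1_card [RHS]big_mkcond /=.
rewrite -(eq_bigl _ _ (in_setT (T := T))) (set_partition_big _ partP) /=.
apply: eq_bigr => B _; rewrite -big_mkcondr -sum1_card.
by apply: eq_bigl => x; rewrite inE andbC.
Qed.

Lemma card_k_coalition_partition (V : finType) (e : rel V) (k : nat)
    (P : {set {set V}}) :
  (min_degree e < k)%N -> (k <= (max_degree e).+1)%N ->
  k_coalition_partition e k P -> (#|P| + k <= max_degree e + 3)%N.
Proof.
move=> hk hkmax /andP[partP /forall_inP coalP].
have [le_P2|lt_2P] := leqP #|P| 2.
  by rewrite (leq_trans (leq_add le_P2 hkmax)) // addnC addSnnS.
have /and3P[/eqP coverP tiP P0] := partP.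
have /card_gt0P[B0 PB0] : (0 < #|P|)%N by apply: leq_trans lt_2P.
have /set0Pn[v0 _] : B0 != set0 by apply: contraNneq P0 => <-.
have [v lt_vk] := exists_low_degree hk v0.
have covered w : exists2 B, B \in P & w \in B.
  by apply/bigcupP; rewrite -/(cover P) coverP.
have [A PA vA] := covered v.
have blockE B C w : B \in P -> C \in P -> w \in B -> w \in C -> B = C.
  move=> PB PC wB wC.
  by rewrite -(def_pblock tiP PB wB) (def_pblock tiP PC wC).
have coalA B : B \in P -> B != A ->
    ~~ k_dominating e k A /\ k_dominating e k (A :|: B).
  move=> PB neqBA.
  have vNB : v \notin B by apply: contra neqBA => vB; rewrite (blockE B A v).
  (* [B] misses [v], so it is not [k]-dominating, and its partner must contain [v], hence is [A]. *)
  have /orP[/andP[domB _]|] := coalP B PB.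
    by rewrite (k_dominating_low_degree lt_vk domB) in vNB.
  case/exists_inP=> C PC /and4P[_ _ domNC domBC].
  have := k_dominating_low_degree lt_vk domBC.
  rewrite inE (negPf vNB) /= => vC.
  by rewrite (blockE A C v) // setUC.
have ndomA : ~~ k_dominating e k A.
  have /card_gt0P[B] : (0 < #|P :\ A|)%N.
    by move: lt_2P; rewrite (cardsD1 A) PA => /ltnW.
  by rewrite in_setD1 => /andP[neqBA PB]; have [] := coalA B PB neqBA.
have /forall_inPn[u] := ndomA; rewrite inE -ltnNge => uNA lt_uAk.
have [U PU uU] := covered u.
have neqUA : U != A by apply: contraNneq uNA => <-.
set N := neighbours e u in lt_uAk.
pose Q := P :\ A :\ U.
have cardQ : #|P| = #|Q|.+2.
  by rewrite (cardsD1 A) PA (cardsD1 U (P :\ A)) in_setD1 neqUA PU.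
(* [u] lies outside [A :|: B], so at least [k] of its neighbours lie there. *)
have contrib B : B \in Q -> (k - #|N :&: A| <= #|N :&: B|)%N.
  rewrite !in_setD1 => /and3P[neqBU neqBA PB].
  have [_ /forall_inP/(_ u)] := coalA B PB neqBA.
  have uNB : u \notin B by apply: contra neqBU => uB; rewrite (blockE B U u).
  rewrite !inE (negPf uNA) (negPf uNB) => /(_ isT) le_k.
  by rewrite leq_subLR (leq_trans le_k) // setIUr cardsU leq_subr.
have deg_u : (#|N :&: A| + #|Q| * (k - #|N :&: A|) <= max_degree e)%N.
  apply: leq_trans (leq_bigmax u).
  rewrite /degree -/N -(sum_card_setI_partition N partP) (big_setD1 A) //=.
  rewrite leq_add2l (big_setD1 U) ?in_setD1 ?neqUA //=.
  (* Neighbours of [u] in its own block [U] are discarded. *)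
  rewrite (leq_trans _ (leq_addl _ _)) // -sum_nat_const.
  exact: leq_sum.
have Q_gt0 : (0 < #|Q|)%N by rewrite cardQ in lt_2P.
(* With a = [#|N :&: A|] and q = [#|Q|]: a + q(k - a) = k + (q - 1)(k - a) >= k + q - 1, as q >= 1
   and k - a >= 1. *)
move: deg_u lt_uAk Q_gt0; rewrite cardQ.
by nia.
Qed.

(* The hypothesis hkmax is needed: for k >= max_degree + 2 the only
   k-dominating set is the whole vertex set, so the k-coalition number of any
   graph with at least two vertices is 2, exceeding max_degree - k + 3. *)
Theorem theorem3 (V : finType) (e : rel V)
    (esym : symmetric e) (eirr : irreflexive e) (k : nat)
    (hk : (min_degree e < k)%N) (hkmax : (k <= (max_degree e).+1)%N) :
  (k_coalition_number e k)%:Z <= (max_degree e)%:Z - k%:Z + 3.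
Proof.
(* By [hkmax] the truncated subtraction is exact. *)
suff : (k_coalition_number e k <= max_degree e + 3 - k)%N by lia.
apply/bigmax_leqP => P coalP.
have := card_k_coalition_partition _ _ _ _ hk hkmax coalP; lia.
Qed.
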